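(* Let $X$ be a set, let $m,n\ge 2$ be integers, and let $f\in\Omega_m(X)$. Then $f\in\mathcal{Q}_m(X)$ if and only if $\odot_f\in\mathcal{Q}_m(\Omega_n(X))$.
   Context: For a set $Y$, $\Omega_m(Y)$ is the set of all $m$-ary operations $Y^m\to Y$, and $\mathcal{Q}_m(Y)\subset\Omega_m(Y)$ is the set of $m$-ary quasigroup operations: $f\in\mathcal{Q}_m(Y)$ iff for each $1\le i\le m$, all $(a_1,\ldots,a_{i-1},a_{i+1},\ldots,a_m)\in Y^{m-1}$ and all $b\in Y$, there is a unique $a_i\in Y$ with $f(a_1,\ldots,a_m)=b$. For $f\in\Omega_m(X)$, the $m$-ary operation $\odot_f:(\Omega_n(X))^m\to\Omega_n(X)$ on the set $\Omega_n(X)$ is defined by $\odot_f(g_1,\ldots,g_m)(\overline a):=f(g_1(\overline a),\ldots,g_m(\overline a))$ for all $g_1,\ldots,g_m\in\Omega_n(X)$ and $\overline a\in X^n$. *)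

(* Defs.v *)
From mathcomp Require Import all_boot.

Set Implicit Arguments.
Unset Strict Implicit.
Unset Printing Implicit Defensive.

(* [(Y ^ m)%type] is MathComp's [{ffun 'I_m -> Y}]; coordinates are numbered
   from 0 to m - 1. *)
Definition Omega (m : nat) (Y : Type) : Type := (Y ^ m)%type -> Y.

(* The m-tuple whose i-th coordinate is y and whose other coordinates are, in
   order, those of a: [unlift i j] is [None] when j = i, and otherwise the
   position of j once i is skipped. *)
Definition insert_at (m : nat) (Y : Type) (i : 'I_m) (y : Y)
    (a : (Y ^ m.-1)%type) : (Y ^ m)%type :=
  [ffun j => oapp a y (unlift i j)].

Definition quasigroup_op (m : nat) (Y : Type) (f : Omega m Y) : Prop :=
  forall (i : 'I_m) (a : (Y ^ m.-1)%type) (b : Y),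
    exists! y : Y, f (insert_at i y a) = b.

Definition odot (m n : nat) (X : Type) (f : Omega m X) : Omega m (Omega n X) :=
  fun g a => f [ffun i => g i a].

Arguments odot {m} n {X} f.

(* Main.v *)
Require Import Defs.
From mathcomp Require Import all_boot.
From Stdlib Require Import FunctionalExtensionality IndefiniteDescription.

(** The operation [odot n f] acts pointwise, so an equation for it with one
    unknown operation is a family of equations for [f], one at each point.
    Unique solvability of all of these gives, by choice, unique solvability of
    the former; conversely, an equation for [f] is recovered by taking constant
    operations as coefficients. *)

(** Evaluation at [x] acts coordinate by coordinate, so it commutes with insertion. *)
Lemma odot_insert_at (X : Type) (m n : nat) (f : Omega m X) (i : 'I_m)
    (h : Omega n X) (a : (Omega n X ^ m.-1)%type) (x : (X ^ n)%type) :
  odot n f (insert_at i h a) x = f (insert_at i (h x) [ffun k => a k x]).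
Proof.
rewrite /odot; congr f; apply/ffunP => j; rewrite !ffunE.
by case: (unlift i j) => //= k; rewrite ffunE.
Qed.

Lemma odot_quasigroup_op (X : Type) (m n : nat) (f : Omega m X) :
  quasigroup_op f -> quasigroup_op (odot n f).
Proof.
move=> qf i a b.
(* Choosing along [unique] keeps in [hP] the uniqueness at each point, needed for that of [h]. *)
have [|h hP] := functional_choice
    (fun x y => unique (fun z => f (insert_at i z [ffun k => a k x]) = b x) y).
  by move=> x; apply: qf.
exists h; split=> [|h' h'P]; apply: functional_extensionality => x.
  by rewrite odot_insert_at (hP x).1.
by apply: (hP x).2; rewrite -odot_insert_at h'P.
Qed.

Lemma quasigroup_op_of_odot (X : Type) (m n : nat) (f : Omega m X) :
  quasigroup_op (odot n f) -> quasigroup_op f.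
Proof.
move=> qf i a b.
pose ca : (Omega n X ^ m.-1)%type := [ffun k => fun=> a k].
have caE x : [ffun k => ca k x] = a by apply/ffunP => k; rewrite !ffunE.
have [h [hP h_uniq]] := qf i ca (fun=> b).
(* Any point of [X ^ n] would do here; [b] supplies one. *)
exists (h [ffun=> b]); split=> [|y yP].
  by rewrite -[in LHS](caE [ffun=> b]) -odot_insert_at hP.
(* The constant operation with value [y] solves the lifted equation too, hence equals [h]. *)
rewrite (h_uniq (fun=> y)) //; apply: functional_extensionality => x.
by rewrite odot_insert_at caE.
Qed.

Theorem proposition4p1 (X : Type) (m n : nat) (hm : 2 <= m) (hn : 2 <= n)
    (f : Omega m X) :
  quasigroup_op f <-> quasigroup_op (odot n f).
Proof.
split; [exact: odot_quasigroup_op | exact: quasigroup_op_of_odot].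
Qed.
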